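(* Let $1\le k\le n$. Then $$d_{\mathrm{cb}}(H_n^k,H_n^n)\,d_{\mathrm{cb}}(H_n^k,H_n^1)=d_{\mathrm{cb}}(H_n^n,H_n^1),$$ so that in the metric space of all $n$-dimensional operator spaces (up to complete isometry) with metric $\log d_{\mathrm{cb}}$, the three points $H_n^k$, $H_n^1$, $H_n^n$ form a degenerate triangle.
   Context: Definition of $H_n^k$. Let $1\le k\le n$. Let $I=\{i_1<\cdots<i_{k-1}\}$ range over the subsets of $\{1,\ldots,n\}$ of cardinality $k-1$ (there are $q=\binom{n}{k-1}$ of them) and $J=\{j_1<\cdots<j_{n-k}\}$ over the subsets of cardinality $n-k$ (there are $p=\binom{n}{n-k}$ of them), each collection ordered lexicographically. Let $\{e_I\}$ and $\{e_J\}$ be the canonical bases of column vectors of $\mathbf{C}^q$ and $\mathbf{C}^p$, indexed by these subsets, and let $e_{J,I}=e_Je_I^t\in M_{p,q}(\mathbf{C})=B(\mathbf{C}^q,\mathbf{C}^p)$. For $1\le i\le n$ put $$b_i^{n,k}=\sum_{I\cap J=\emptyset,\ (I\cup J)^c=\{i\}}\epsilon(I,i,J)\,e_{J,I},$$ where $\epsilon(I,i,J)$ is the signature of the permutation taking $(i_1,\ldots,i_{k-1},i,j_1,\ldots,j_{n-k})$ to $(1,\ldots,n)$. Then $H_n^k$ is the linear span of $b_1^{n,k},\ldots,b_n^{n,k}$, with the operator space structure inherited from $B(\mathbf{C}^q,\mathbf{C}^p)$. In particular $H_n^1=B(\mathbf{C},\mathbf{C}^n)$ is the column Hilbert space $C_n$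 and $H_n^n=B(\mathbf{C}^n,\mathbf{C})$ is the row Hilbert space $R_n$. The completely bounded Banach-Mazur distance between completely isomorphic operator spaces $E,F$ is $d_{\mathrm{cb}}(E,F)=\inf\{\|u\|_{\mathrm{cb}}\|u^{-1}\|_{\mathrm{cb}}\}$, the infimum being over all complete isomorphisms $u:E\to F$ (linear bijections with $u$ and $u^{-1}$ completely bounded). A triangle in a metric space is degenerate when equality holds in one of its triangle inequalities. *)

(* Defs.v *)
(* The real numbers are an arbitrary R : realType, the complex numbers R[i]. *)
From HB Require Import structures.
From mathcomp Require Import all_boot all_order fingroup perm all_algebra.
From mathcomp Require Import all_classical all_reals all_analysis.
From mathcomp Require Import complex.

Set Implicit Arguments.
Unset Strict Implicit.
Unset Printing Implicit Defensive.
Import Order.TTheory GRing.Theory Num.Theory.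
Import numFieldNormedType.Exports.

Local Open Scope classical_set_scope.
Local Open Scope ring_scope.

Section HilbertDef.
Variable R : realType.

Definition dot_norm (U : lmodType R[i]) (f : {dot U for Num.conj}) (x : U) : R :=
  Num.sqrt (complex.Re (f x x)).

Definition dot_complete (U : lmodType R[i]) (f : {dot U for Num.conj}) : Prop :=
  forall u : nat -> U,
    (forall e : R, 0 < e -> exists N, forall i j,
       (N <= i)%N -> (N <= j)%N -> dot_norm f (u i - u j) < e) ->
    exists l : U, (dot_norm f (u i - l)) @[i --> \oo] --> (0 : R).

Record hilbert := Hilbert {
  hilb_space :> lmodType R[i];
  hilb_dot : {dot hilb_space for Num.conj};
  hilb_complete : dot_complete hilb_dot
}.

Definition hnorm (H : hilbert) (x : H) : R := dot_norm (hilb_dot H) x.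

(* The norm of the Hilbert direct sum H^N. *)
Definition hnormN (H : hilbert) (N : nat) (h : 'I_N -> H) : R :=
  Num.sqrt (\sum_j hnorm (h j) ^+ 2).

End HilbertDef.

Section OpSpace.
Variable R : realType.

(* A finite-dimensional (concrete) operator space: a finite-dimensional complex
   vector space identified with a linear subspace of B(H, K) through the
   injective linear map x |-> os_op x. *)
Record opspace := OpSpace {
  os_space :> vectType R[i];
  os_dom : hilbert R;
  os_cod : hilbert R;
  os_op : {bilinear os_space -> os_dom -> os_cod};
  os_bounded : forall x, exists M : R, forall h,
    hnorm (os_op x h) <= M * hnorm h;
  os_inj : forall x, (forall h, os_op x h = 0) -> x = 0
}.

Definition osdim (E : opspace) : nat := \dim {: E}.

(* The norm of M_N(E): an N x N matrix x over E acts as an operator from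
   H^N to K^N, where E is realized in B(H, K). *)
Definition mxnorm (E : opspace) (N : nat) (x : 'M[E]_N) : \bar R :=
  ereal_sup [set (hnormN (fun i => \sum_j os_op E (x i j) (h j)))%:E
            | h in [set h : 'I_N -> os_dom E | hnormN h <= 1]].

Definition amplnorm (E F : opspace) (u : 'Hom(E, F)) (N : nat) : \bar R :=
  ereal_sup [set mxnorm (map_mx u x) | x in [set x : 'M[E]_N | (mxnorm x <= 1)%E]].

Definition cbnorm (E F : opspace) (u : 'Hom(E, F)) : \bar R :=
  ereal_sup (range (amplnorm u)).

Definition completely_bounded (E F : opspace) (u : 'Hom(E, F)) : Prop :=
  (cbnorm u < +oo)%E.

(* uv = (u, u^-1) for a complete isomorphism u : E -> F. *)
Definition complete_iso_pair (E F : opspace)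
    (uv : 'Hom(E, F) * 'Hom(F, E)) : Prop :=
  [/\ cancel uv.1 uv.2, cancel uv.2 uv.1,
      completely_bounded uv.1 & completely_bounded uv.2].

(* The value is +oo when E and F are not completely isomorphic. *)
Definition dcb (E F : opspace) : \bar R :=
  ereal_inf [set (cbnorm uv.1 * cbnorm uv.2)%E
            | uv in [set uv | @complete_iso_pair E F uv]].

(* The real logarithm; 0 by convention when dcb E F is infinite, which does not
   happen between spaces of the same finite dimension. *)
Definition log_dcb (E F : opspace) : R := ln (fine (dcb E F)).

Definition degenerate_triangle (T : Type) (d : T -> T -> R) (x y z : T) : Prop :=
  [\/ d x z = d x y + d y z, d x y = d x z + d z y | d y z = d y x + d x z].

End OpSpace.

Section StandardHilbert.
Variables (R : realType) (q : nat).

Definition cVdot (u v : 'cV[R[i]]_q) : R[i] := \sum_i u i 0 * (v i 0)^*.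

Fact cVdot_bilinear :
  bilinear_for (GRing.mul : R[i] -> R[i] -> R[i])
     (Num.conj \; *%R : R[i] -> R[i] -> R[i]) cVdot.
Proof.
split=> [v a x y|u a x y]; rewrite /cVdot /= mulr_sumr -big_split /=;
  apply: eq_bigr => i _; rewrite !mxE.
- by rewrite mulrDl mulrA.
- by rewrite rmorphD rmorphM mulrDr mulrCA.
Qed.

HB.instance Definition _ := bilinear_isBilinear.Build R[i] _ _ _ _ _
  cVdot cVdot_bilinear.

Fact cVdot_herm u v : cVdot u v = (-1) ^+ false * (cVdot v u)^*.
Proof.
rewrite expr0 mul1r /cVdot rmorph_sum; apply: eq_bigr => i _.
by rewrite rmorphM /= conjCK mulrC.
Qed.

HB.instance Definition _ := isHermitianSesquilinear.Build R[i] _ _ _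
  cVdot cVdot_herm.

Fact cVdot_gt0 u : u != 0 -> 0 < cVdot u u.
Proof.
move=> u0; rewrite lt_def; apply/andP; split; last first.
  by apply: sumr_ge0 => i _; rewrite -normCK exprn_ge0.
apply: contra u0; rewrite psumr_eq0 => [/allP h|i _]; last by rewrite -normCK exprn_ge0.
apply/eqP/matrixP => i j; rewrite ord1 mxE; apply/eqP.
by have := h i (mem_index_enum _); rewrite -normCK expf_eq0 normr_eq0.
Qed.

HB.instance Definition _ := isDotProduct.Build R[i] _ cVdot cVdot_gt0.

Let cVnorm (u : 'cV[R[i]]_q) : R := dot_norm cVdot u.

Lemma dot_norm_cVdot (u : 'cV[R[i]]_q) :
  cVnorm u = Num.sqrt (\sum_i Normc.normc (u i 0) ^+ 2).
Proof.
rewrite /cVnorm /dot_norm /cVdot raddf_sum; congr (Num.sqrt _).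
apply: eq_bigr => i _; case: (u i 0) => a b /=.
by rewrite sqr_sqrtr ?addr_ge0 ?sqr_ge0 // -!expr2 mulrN opprK.
Qed.

Let normc_ge0 (z : R[i]) : 0 <= Normc.normc z.
Proof. by case: z => a b; exact: sqrtr_ge0. Qed.

Lemma normc_le_cVnorm (u : 'cV[R[i]]_q) i : Normc.normc (u i 0) <= cVnorm u.
Proof.
rewrite dot_norm_cVdot -[leLHS]ger0_norm // -sqrtr_sqr ler_wsqrtr //.
by rewrite (bigD1 i) //= lerDl sumr_ge0 // => j _; rewrite sqr_ge0.
Qed.

Lemma cVnorm_le_sum (u : 'cV[R[i]]_q) : cVnorm u <= \sum_i Normc.normc (u i 0).
Proof.
have S0 : 0 <= \sum_i Normc.normc (u i 0) by apply: sumr_ge0.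
rewrite dot_norm_cVdot -[leRHS]ger0_norm // -sqrtr_sqr ler_wsqrtr //.
suff [] : \sum_i Normc.normc (u i 0) ^+ 2 <= (\sum_i Normc.normc (u i 0)) ^+ 2 /\
   0 <= \sum_i Normc.normc (u i 0) by [].
apply: (big_rec2 (fun x y => x <= y ^+ 2 /\ 0 <= y)) => [|i y x _ [xy y0]].
  by rewrite expr0n.
split; last exact: addr_ge0.
rewrite sqrrD addrAC; apply: (le_trans (lerD (lexx _) xy)).
by rewrite lerDl mulrn_wge0 // mulr_ge0.
Qed.

Lemma cVdot_complete : dot_complete (@cVdot : {dot 'cV[R[i]]_q for Num.conj}).
Proof.
move=> u cu.
have real_cvg (f : 'cV[R[i]]_q -> R) :
    (forall x y, `|f x - f y| <= cVnorm (x - y)) ->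
    exists l : R, f (u n) @[n --> \oo] --> l.
  move=> fE; apply/cvg_ex/cauchy_cvgP/cauchy_exP => e e0.
  have [N HN] := cu e e0; exists (f (u N)); exists N => // n /= Nn.
  by rewrite /ball /=; apply: le_lt_trans (fE _ _) _; exact: HN.
have normc_Re (z : R[i]) : `|complex.Re z| <= Normc.normc z.
  case: z => a b /=; rewrite -sqrtr_sqr ler_wsqrtr //.
  by rewrite lerDl sqr_ge0.
have normc_Im (z : R[i]) : `|complex.Im z| <= Normc.normc z.
  case: z => a b /=; rewrite -sqrtr_sqr ler_wsqrtr //.
  by rewrite lerDr sqr_ge0.
have normc_le (z : R[i]) : Normc.normc z <= `|complex.Re z| + `|complex.Im z|.
  case: z => a b /=; rewrite -[leRHS]ger0_norm ?addr_ge0 // -sqrtr_sqr.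
  rewrite ler_wsqrtr // sqrrD !real_normK ?num_real //.
  by rewrite addrAC lerDl mulrn_wge0 // mulr_ge0.
have reP i : exists l : R, complex.Re (u n i 0) @[n --> \oo] --> l.
  apply: (real_cvg (fun x => complex.Re (x i 0))) => x y.
  apply: le_trans (normc_le_cVnorm (x - y) i); rewrite -raddfB.
  by rewrite !mxE; exact: normc_Re.
have imP i : exists l : R, complex.Im (u n i 0) @[n --> \oo] --> l.
  apply: (real_cvg (fun x => complex.Im (x i 0))) => x y.
  apply: le_trans (normc_le_cVnorm (x - y) i); rewrite -raddfB.
  by rewrite !mxE; exact: normc_Im.
have [a aP] := choice reP; have [b bP] := choice imP.
exists (\col_i Complex (a i) (b i)).
have cvg0 (f : nat -> R) l : f n @[n --> \oo] --> l ->
    `|f n - l| @[n --> \oo] --> (0 : R).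
  move=> fl; rewrite -(normr0 R) -(subrr l).
  by apply: cvg_norm; apply: cvgB => //; exact: cvg_cst.
apply: (@squeeze_cvgr _ _ _ _ (fun=> 0) (fun n => \sum_i
   (`|complex.Re (u n i 0) - a i| + `|complex.Im (u n i 0) - b i|))).
- apply: nearW => n; rewrite sqrtr_ge0 /=.
  apply: (le_trans (cVnorm_le_sum _)); apply: ler_sum => i _.
  by apply: (le_trans (normc_le _)); rewrite !mxE !raddfB.
- exact: cvg_cst.
- rewrite [X in _ --> X](_ : 0 = \sum_(i < q) (0 : R)); last by rewrite big1.
  apply: cvg_big => [|i _]; first exact: add_continuous.
  rewrite -[X in _ --> X](addr0 (0 : R)).
  by apply: cvgD; apply: cvg0; [exact: aP | exact: bP].
Qed.

Definition cV_hilbert : hilbert R := Hilbert cVdot_complete.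

End StandardHilbert.

Section MatrixOpSpace.
Variables (R : realType) (p q : nat) (V : {vspace 'M[R[i]]_(p, q)}).

Definition mx_op (x : subvs_of V) (h : cV_hilbert R q) : cV_hilbert R p :=
  (vsval x : 'M[R[i]]_(p, q)) *m (h : 'cV[R[i]]_q).

Fact mx_op_bilinear : bilinear_for
  (GRing.scale : R[i] -> cV_hilbert R p -> _)
  (GRing.scale : R[i] -> cV_hilbert R p -> _) mx_op.
Proof.
split=> [h a x y|x a h1 h2]; rewrite /mx_op.
- by rewrite linearP mulmxDl -scalemxAl.
- by rewrite mulmxDr -scalemxAr.
Qed.

HB.instance Definition _ := bilinear_isBilinear.Build R[i] _ _ _ _ _
  mx_op mx_op_bilinear.

Fact mx_op_bounded (x : subvs_of V) : exists M : R, forall h,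
  hnorm (mx_op x h) <= M * hnorm h.
Proof.
exists (\sum_i \sum_j Normc.normc ((vsval x : 'M[R[i]]_(p, q)) i j)) => h.
apply: (le_trans (cVnorm_le_sum _)); rewrite mulr_suml; apply: ler_sum => i _.
rewrite mxE mulr_suml.
apply: (@le_trans _ _ (\sum_j Normc.normc ((vsval x : 'M[R[i]]_(p, q)) i j *
    (h : 'cV[R[i]]_q) j 0))).
  apply: (big_rec2 (fun y z => Normc.normc y <= z)) => [|j y z _ yz].
    by rewrite Normc.normc0.
  by apply: (le_trans (le_normcD _ _)); rewrite lerD2l.
apply: ler_sum => j _; rewrite Normc.normcM ler_wpM2l //.
  by case: (_ i j) => ? ?; exact: sqrtr_ge0.
exact: (normc_le_cVnorm (h : 'cV[R[i]]_q)).
Qed.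

Fact mx_op_inj (x : subvs_of V) : (forall h, mx_op x h = 0) -> x = 0.
Proof.
move=> x0; apply/val_inj/matrixP => i j; rewrite [RHS]mxE.
have /matrixP/(_ i 0) := x0 (delta_mx j 0).
by rewrite /mx_op -colE !mxE.
Qed.

(* A subspace of M_{p,q}(C) = B(C^q, C^p), with the inherited structure. *)
Definition mx_opspace : opspace R :=
  @OpSpace R (subvs_of V) (cV_hilbert R q) (cV_hilbert R p) mx_op
    mx_op_bounded mx_op_inj.

End MatrixOpSpace.

Local Close Scope classical_set_scope.

Section Hnk.
Variables (R : realType) (n : nat).

(* The subsets of 'I_n of cardinality m, in lexicographic order of their
   increasing enumerations. *)
Definition lex_subsets (m : nat) : seq {set 'I_n} :=
  sort (fun A B : {set 'I_n} => (enum A <= enum B :> seqlexi 'I_n)%O)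
       (enum [set A : {set 'I_n} | #|A| == m]).

(* The signature of the permutation taking (i_1, ..., i_{k-1}, i, j_1, ...)
   to (1, ..., n). *)
Definition signature (I : {set 'I_n}) (i : 'I_n) (J : {set 'I_n}) : R[i] :=
  if [pick s : 'S_n | [seq s x | x <- enum I ++ i :: enum J] == enum 'I_n]
  is Some s then (-1) ^+ s else 0.

(* delta_mx a b = e_a e_b^t, where a and b are the lexicographic positions of
   J and I. *)
Definition bvec (k : nat) (i : 'I_n) : 'M[R[i]]_('C(n, n - k), 'C(n, k.-1)) :=
  \sum_(a < 'C(n, n - k)) \sum_(b < 'C(n, k.-1))
    let J := nth finset.set0 (lex_subsets (n - k)) a in
    let I := nth finset.set0 (lex_subsets k.-1) b in
    if (I :&: J == finset.set0) && (~: (I :|: J) == [set i])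
    then signature I i J *: delta_mx a b else 0.

Definition Hspace (k : nat) : opspace R := mx_opspace <<codom (bvec k)>>%VS.

End Hnk.

(* Main.v *)
(** Identify sum_i X_i (x) b_i in M_N(H_n^k) with the family (X_i).  The norm of
    this element is compared with those of (X_i) in M_N(R_n) and in M_N(C_n) by
    summing over all I or all J; together with the Cauchy-Schwarz inequality
    this bounds the completely bounded norms of b_i |-> b_i:
    H_n^k -> R_n and back by (n/k)^(1/2) and (n-k+1)^(1/2), and H_n^k -> C_n and
    back by (n/(n-k+1))^(1/2) and k^(1/2).  The product of these four numbers
    is n.  Conversely, the cb norm of a map between R_n and C_n dominates its
    Hilbert-Schmidt norm, and n = tr(S T) <= |S|_HS |T|_HS; applied to the maps
    T : R_n -> E -> C_n and S : C_n -> E -> R_n this gives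
    n <= d(E, R_n) d(E, C_n) for every E. *)
From HB Require Import structures.
From mathcomp Require Import all_boot all_order fingroup perm all_algebra.
From mathcomp Require Import all_classical all_reals all_analysis.
From mathcomp Require Import complex ring lra zify.
Require Import Defs.

Set Implicit Arguments.
Unset Strict Implicit.
Unset Printing Implicit Defensive.
Import Order.TTheory GRing.Theory Num.Theory.

Local Open Scope ring_scope.

(** * Norms on a Hilbert space and on its finite direct sums *)

Section Hilbert.
Variable R : realType.

Lemma normc_real_complex (a : R) : 0 <= a -> Normc.normc a%:C%C = a.
Proof. by move=> a0; rewrite /= expr0n addr0 sqrtr_sqr ger0_norm. Qed.

Lemma hnormZ (H : hilbert R) (a : R) (x : H) :
  0 <= a -> hnorm (a%:C%C *: x) = a * hnorm x.
Proof.
move=> a0; rewrite /hnorm /dot_norm dnormZ.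
rewrite (ger0_norm (_ : 0 <= a%:C%C)) ?lecR //.
case: (hilb_dot H x x) => u v; rewrite expr2 /=.
rewrite -[X in _ = X * _](ger0_norm a0) -sqrtr_sqr.
by rewrite -sqrtrM ?sqr_ge0 //; congr Num.sqrt; ring.
Qed.

Lemma hnorm0 (H : hilbert R) : hnorm (0 : H) = 0.
Proof. by rewrite /hnorm /dot_norm linear0l /= sqrtr0. Qed.

Lemma hnorm_eq0 (H : hilbert R) (x : H) : hnorm x = 0 -> x = 0.
Proof.
rewrite /hnorm /dot_norm => /eqP; rewrite sqrtr_eq0.
have := dnorm_ge0 (hilb_dot H) x.
case E : (hilb_dot H x x) => [a b]; rewrite lecE /= => /andP[/eqP b0 a0] a1.
apply/eqP; rewrite -(dnorm_eq0 (hilb_dot H)) E; apply/eqP.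
by rewrite b0; have -> : a = 0 by apply/eqP; rewrite eq_le a0 a1.
Qed.

Lemma hnormN_ge0 (H : hilbert R) N (h : 'I_N -> H) : 0 <= hnormN h.
Proof. exact: sqrtr_ge0. Qed.

Lemma hnormNZ (H : hilbert R) N (a : R) (h : 'I_N -> H) :
  0 <= a -> hnormN (fun i : 'I_N => a%:C%C *: h i : H) = a * hnormN h.
Proof.
move=> a0; rewrite -[X in _ = X * _](ger0_norm a0) -sqrtr_sqr.
rewrite -sqrtrM ?sqr_ge0 //.
congr Num.sqrt; rewrite mulr_sumr; apply: eq_bigr => i _.
by rewrite hnormZ // exprMn.
Qed.

Lemma hnormN0 (H : hilbert R) N : hnormN (fun _ : 'I_N => 0 : H) = 0.
Proof. by rewrite /hnormN big1 ?sqrtr0 // => i _; rewrite hnorm0 expr0n. Qed.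

Lemma hnormN_eq0 (H : hilbert R) N (h : 'I_N -> H) :
  hnormN h = 0 -> forall i, h i = 0.
Proof.
move=> /eqP; rewrite sqrtr_eq0 => h0 i; apply: hnorm_eq0; apply/eqP.
rewrite -sqrf_eq0 eq_le sqr_ge0 andbT; apply: le_trans h0.
by rewrite (bigD1 i) //= lerDl sumr_ge0 // => j _; rewrite sqr_ge0.
Qed.

End Hilbert.

(** * Matrix norms, completely bounded norms and the distance [dcb] *)

Section CompletelyBounded.
Variable R : realType.
Implicit Types E F G : opspace R.

Definition opN E N (x : 'M[E]_N) (h : 'I_N -> os_dom E) : 'I_N -> os_cod E :=
  fun i => \sum_j os_op E (x i j) (h j).

Lemma opNZr E N (x : 'M[E]_N) a h :
  opN x (fun i => a *: h i) = fun i => a *: opN x h i.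
Proof.
by apply/funext => i; rewrite /opN scaler_sumr; apply: eq_bigr => j _; rewrite linearZr.
Qed.

Lemma opNZl E N (x : 'M[E]_N) a h :
  opN (map_mx ( *:%R a) x) h = fun i => a *: opN x h i.
Proof.
apply/funext => i; rewrite /opN scaler_sumr; apply: eq_bigr => j _.
by rewrite mxE linearZl_LR.
Qed.

(** Homogeneity: a vector of nonzero norm is scaled into the unit ball, and a vector of norm 0 is
    0. *)
Lemma mxnorm_leP E N (x : 'M[E]_N) (M : R) : 0 <= M ->
  reflect (forall h, hnormN (opN x h) <= M * hnormN h) (mxnorm x <= M%:E)%E.
Proof.
move=> M0; apply: (iffP idP) => [xM h|xM]; last first.
  apply: ge_ereal_sup => _ [h /= h1 <-]; rewrite lee_fin.
  by apply: le_trans (xM h) _; rewrite ler_piMr.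
have [h0|h0] := eqVneq (hnormN h) 0.
  rewrite h0 mulr0 (_ : opN x h = fun=> 0) ?hnormN0 //.
  apply/funext => i; rewrite /opN big1 // => j _.
  by rewrite (hnormN_eq0 h0) linear0r.
have hgt : 0 < hnormN h by rewrite lt_def h0 hnormN_ge0.
have ih0 : 0 <= (hnormN h)^-1 by rewrite invr_ge0 ltW.
have : ((hnormN (opN x (fun i => ((hnormN h)^-1)%:C%C *: h i)))%:E <= M%:E)%E.
  apply: le_trans xM; apply: ereal_sup_ubound.
  by exists (fun i => ((hnormN h)^-1)%:C%C *: h i) => //=; rewrite hnormNZ // mulVf.
by rewrite lee_fin opNZr hnormNZ // mulrC ler_pdivrMr.
Qed.

(** The zero matrix of size 0 already contributes the value 0 to the supremum. *)
Lemma cbnorm_ge0 E F (u : 'Hom(E, F)) : (0 <= cbnorm u)%E.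
Proof.
apply: (@le_trans _ _ (amplnorm u 0)); last by apply: ereal_sup_ubound; exists 0%N.
apply: (@le_trans _ _ (mxnorm (map_mx u (0 : 'M[E]_0)))).
  apply: ereal_sup_ubound; exists (fun=> 0) => /=; first by rewrite hnormN0.
  by congr EFin; apply/eqP; rewrite sqrtr_eq0 big_ord0.
apply: ereal_sup_ubound; exists 0 => //=.
by apply/mxnorm_leP => // h; rewrite /hnormN !big_ord0 sqrtr0 mulr0.
Qed.

Lemma cbnorm_le E F (u : 'Hom(E, F)) (c : R) :
  (forall N (x : 'M[E]_N), (mxnorm x <= 1)%E -> (mxnorm (map_mx u x) <= c%:E)%E) ->
  (cbnorm u <= c%:E)%E.
Proof.
by move=> uc; apply: ge_ereal_sup => _ [N _ <-]; apply: ge_ereal_sup => _ [x /= x1 <-]; exact: uc.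
Qed.

(** The amplification is controlled on the unit ball only, so [x] is divided by some [M' > M], which
    is invertible even when [M = 0]; then [M'] tends to [M]. *)
Lemma mxnorm_map_le E F (u : 'Hom(E, F)) N (x : 'M[E]_N) (c M : R) :
  (cbnorm u <= c%:E)%E -> 0 <= M -> (mxnorm x <= M%:E)%E ->
  (mxnorm (map_mx u x) <= (c * M)%:E)%E.
Proof.
move=> uc M0 xM.
have c0 : 0 <= c by rewrite -lee_fin (le_trans (cbnorm_ge0 u)).
apply/mxnorm_leP => [|h]; first exact: mulr_ge0.
suff bnd (M' : R) : M < M' -> hnormN (opN (map_mx u x) h) <= M' * (c * hnormN h).
  rewrite mulrAC [_ * M]mulrC -subr_ge0.
  have [ch0|ch0] := eqVneq (c * hnormN h) 0.
    by have := bnd (M + 1); rewrite ltrDl ltr01 ch0 !mulr0 subr_ge0 => ->.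
  rewrite subr_ge0; apply/ler_addgt0Pl => e e0.
  have chgt : 0 < c * hnormN h by rewrite lt_def ch0 mulr_ge0 ?hnormN_ge0.
  (* This increment of [M] raises the bound by exactly [e]. *)
  have := bnd (M + e / (c * hnormN h)); rewrite ltrDl divr_gt0 // => /(_ isT).
  by rewrite mulrDl divfK // addrC.
move=> MM'; have M'0 : 0 < M' by exact: le_lt_trans MM'.
have iM'0 : 0 <= M'^-1 by rewrite invr_ge0 ltW.
pose y := map_mx ( *:%R (M'^-1)%:C%C) x.
have y1 : (mxnorm y <= 1%:E)%E.
  apply/mxnorm_leP => // g; rewrite opNZl hnormNZ // mul1r mulrC ler_pdivrMr //.
  move/mxnorm_leP : xM => /(_ M0) xM; apply: le_trans (xM g) _.
  by rewrite mulrC ler_wpM2l ?hnormN_ge0 // ltW.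
have : (mxnorm (map_mx u y) <= c%:E)%E.
  apply: le_trans uc; apply: (@le_trans _ _ (amplnorm u N)).
    by apply: ereal_sup_ubound; exists y.
  by apply: ereal_sup_ubound; exists N.
move=> /mxnorm_leP => /(_ c0 h).
have -> : map_mx u y = map_mx ( *:%R (M'^-1)%:C%C) (map_mx u x).
  by apply/matrixP => i j; rewrite !mxE linearZ.
by rewrite opNZl hnormNZ // mulrC ler_pdivrMr // [_ * M']mulrC.
Qed.

Lemma cbnorm_comp E F G (u : 'Hom(E, F)) (v : 'Hom(F, G)) (c d : R) :
  (cbnorm u <= c%:E)%E -> (cbnorm v <= d%:E)%E -> (cbnorm (v \o u)%VF <= (d * c)%:E)%E.
Proof.
move=> uc vd; apply: cbnorm_le => N x x1.
have -> : map_mx (v \o u)%VF x = map_mx v (map_mx u x).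
  by apply/matrixP => i j; rewrite !mxE comp_lfunE.
apply: mxnorm_map_le => //; first by rewrite -lee_fin (le_trans (cbnorm_ge0 u)).
by rewrite -[c]mulr1; exact: mxnorm_map_le.
Qed.

Lemma dcb_ge0 E F : (0 <= dcb E F)%E.
Proof. by apply: le_ereal_inf_tmp => _ [uv _ <-]; rewrite mule_ge0 ?cbnorm_ge0. Qed.

Lemma dcb_sym E F : dcb E F = dcb F E.
Proof.
by congr ereal_inf; apply/seteqP; split=> _ [[u v] /= [? ? ? ?] <-];
  exists (v, u) => //=; rewrite muleC.
Qed.

Lemma dcb_le E F (u : 'Hom(E, F)) (v : 'Hom(F, E)) (c d : R) :
  cancel u v -> cancel v u -> (cbnorm u <= c%:E)%E -> (cbnorm v <= d%:E)%E ->
  (dcb E F <= (c * d)%:E)%E.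
Proof.
move=> uv vu uc vd; apply: (@le_trans _ _ (cbnorm u * cbnorm v)%E).
  apply: ereal_inf_lbound; exists (u, v) => //.
  by split => //; [apply: le_lt_trans uc _|apply: le_lt_trans vd _]; rewrite ltry.
by rewrite EFinM; apply: lee_pmul => //; exact: cbnorm_ge0.
Qed.

End CompletelyBounded.

(** * Squared norms on C^N and the Cauchy-Schwarz inequality *)

Section SquareNorm.
Variable R : realType.
Local Notation C := R[i].

Definition abs2 (z : C) : R := Normc.normc z ^+ 2.

Lemma abs2_ge0 z : 0 <= abs2 z. Proof. exact: sqr_ge0. Qed.

Lemma abs2M z w : abs2 (z * w) = abs2 z * abs2 w.
Proof. by rewrite /abs2 Normc.normcM exprMn. Qed.

Lemma abs2_0 : abs2 0 = 0. Proof. by rewrite /abs2 Normc.normc0 expr0n. Qed.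

Lemma abs2_1 : abs2 1 = 1. Proof. by rewrite /abs2 Normc.normc1 expr1n. Qed.

Lemma abs2_nat m : abs2 m%:R = m%:R ^+ 2.
Proof. by rewrite -(rmorph_nat (real_complex R)) /abs2 normc_real_complex. Qed.

Lemma abs2_conj z : abs2 z^* = abs2 z.
Proof. by rewrite /abs2; case: z => a b /=; rewrite sqrrN. Qed.

Lemma mul_conj_abs2 z : z * z^* = (abs2 z)%:C%C.
Proof.
rewrite /abs2; case: z => a b /=; rewrite sqr_sqrtr ?addr_ge0 ?sqr_ge0 //.
by apply/eqP; rewrite eq_complex /=; apply/andP; split; apply/eqP; ring.
Qed.

(** Lagrange's identity: twice the difference of the two sides is the sum of the squares of x_i y_j
    - x_j y_i. *)
Lemma sqr_sum_mul_le (I : finType) (P : pred I) (x y : I -> R) :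
  (\sum_(i | P i) x i * y i) ^+ 2 <=
  (\sum_(i | P i) x i ^+ 2) * (\sum_(i | P i) y i ^+ 2).
Proof.
rewrite expr2 !big_distrlr /= -subr_ge0 -sumrB.
under eq_bigr do rewrite -sumrB.
set S := (X in 0 <= X).
have SE : S + S = \sum_(i | P i) \sum_(j | P j) (x i * y j - x j * y i) ^+ 2.
  rewrite /S {2}exchange_big -big_split /=; apply: eq_bigr => i _.
  by rewrite -big_split; apply: eq_bigr => j _ /=; ring.
have : 0 <= S + S by rewrite SE; do 2!apply: sumr_ge0 => ? _; exact: sqr_ge0.
by lra.
Qed.

Lemma abs2_sum_mul_le (I : finType) (P : pred I) (z w : I -> C) :
  abs2 (\sum_(i | P i) z i * w i) <=
  (\sum_(i | P i) abs2 (z i)) * (\sum_(i | P i) abs2 (w i)).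
Proof.
apply: le_trans (sqr_sum_mul_le _ _ _).
rewrite /abs2 lerXn2r // ?nnegrE ?sumr_ge0 // => [|i _|].
- by case: (\sum_(i | P i) z i * w i) => ? ?; exact: sqrtr_ge0.
- by case: (z i) (w i) => ? ? [? ?]; rewrite mulr_ge0 ?sqrtr_ge0.
apply: (big_rec2 (fun y z => Normc.normc y <= z)) => [|i u v _ uv].
  by rewrite Normc.normc0.
by rewrite -Normc.normcM; apply: (le_trans (le_normcD _ _)); rewrite lerD2l.
Qed.

Definition nsq N (v : 'cV[C]_N) : R := \sum_a abs2 (v a 0).

Lemma nsq_ge0 N (v : 'cV[C]_N) : 0 <= nsq v.
Proof. by apply: sumr_ge0 => a _; exact: abs2_ge0. Qed.

Lemma nsq0 N : nsq (0 : 'cV[C]_N) = 0.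
Proof. by rewrite /nsq big1 // => a _; rewrite mxE abs2_0. Qed.

Lemma nsqZ N a (v : 'cV[C]_N) : nsq (a *: v) = abs2 a * nsq v.
Proof. by rewrite /nsq mulr_sumr; apply: eq_bigr => i _; rewrite mxE abs2M. Qed.

(** Cauchy-Schwarz against the constant family 1, in each coordinate. *)
Lemma nsq_sum_le N (I : finType) (P : pred I) (v : I -> 'cV[C]_N) :
  nsq (\sum_(i | P i) v i) <= #|P|%:R * \sum_(i | P i) nsq (v i).
Proof.
rewrite exchange_big /= mulr_sumr; apply: ler_sum => a _.
rewrite summxE (eq_bigr (fun i => 1 * v i a 0)) => [|i _]; last by rewrite mul1r.
apply: le_trans (abs2_sum_mul_le P (fun=> 1) _) _.
by rewrite (eq_bigr (fun=> 1)) ?sumr_const // => i _; rewrite abs2_1.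
Qed.

(** At most one summand is nonzero, so there are no cross terms. *)
Lemma nsq_sum_single N (I : finType) (P : pred I) (v : I -> 'cV[C]_N) :
  (forall i j, P i -> P j -> v i != 0 -> v j != 0 -> i = j) ->
  nsq (\sum_(i | P i) v i) = \sum_(i | P i) nsq (v i).
Proof.
move=> single; have [i /andP[Pi vi]|v0] := pickP (fun i => P i && (v i != 0)).
  have vj j : P j && (j != i) -> v j = 0.
    move=> /andP[Pj ji]; apply/eqP; apply: contraNT ji => vj.
    by apply/eqP; exact: single.
  rewrite (bigD1 i) //= big1 // addr0 (bigD1 i Pi) /= big1 ?addr0 // => j.
  by move=> /vj ->; rewrite nsq0.
have vj j : P j -> v j = 0.
  by move=> Pj; have := v0 j; rewrite Pj /= => /negbFE/eqP.
by rewrite !big1 ?nsq0 // => j /vj // ->; rewrite nsq0.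
Qed.

End SquareNorm.

(** * The signs in the definition of b_i *)

Section Signature.
Variables (R : realType) (n : nat).

(** The point is to exclude the default value 0 of [signature]: the list [l] contains every index
    exactly once, so a sorting permutation exists. *)
Lemma signature_sqr (I J : {set 'I_n}) i :
  [disjoint I & J] -> ~: (I :|: J) = [set i]%SET -> signature R I i J ^+ 2 = 1.
Proof.
move=> dIJ cIJ; rewrite /signature; case: pickP => [s _|noperm].
  by rewrite -exprM mulnC exprM sqrrN expr1n expr1n.
exfalso; pose l := enum I ++ i :: enum J.
have iIJ : i \notin I :|: J by rewrite -finset.in_setC cIJ inE.
have memIJ x : x \in l.
  rewrite mem_cat inE !mem_enum; have : (x \in ~: (I :|: J)) = (x == i) by rewrite cIJ inE.
  by rewrite !inE; case: (x \in I); case: (x \in J); rewrite ?orbT //= => <-.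
have ul : uniq l.
  rewrite cat_uniq enum_uniq /= enum_uniq mem_enum andbT negb_or.
  move: iIJ; rewrite inE negb_or mem_enum => /andP[-> ->] /=; rewrite andbT.
  apply/hasPn => x; rewrite !mem_enum => xJ.
  by apply: contraTN xJ => xI; rewrite (disjointFr dIJ xI).
have sl : size l = n.
  have /perm_size -> : perm_eq l (enum 'I_n); last by rewrite size_enum_ord.
  by apply: uniq_perm => [//||x]; [exact: enum_uniq | rewrite memIJ mem_enum].
have lt_index x : (index x l < n)%N by rewrite -[X in (_ < X)%N]sl index_mem.
have f_inj : injective (fun x => Ordinal (lt_index x)).
  by move=> x y [] /index_inj ->.
(* The permutation sends each index to its position in [l]. *)
have /eqP[] := noperm (perm f_inj).
apply: (@eq_from_nth _ i) => [|j]; rewrite size_map sl ?size_enum_ord // => jn.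
rewrite (nth_map i) ?sl // permE; apply: val_inj => /=.
by rewrite index_uniq ?sl // nth_enum_ord.
Qed.

End Signature.

(** * Double counting over subsets of fixed cardinality *)

Section SubsetSums.
Variables (V : nmodType) (n : nat).

(** These are the subsets with m elements of the complement of i. *)
Lemma card_sets_avoiding m (i : 'I_n) :
  #|[pred A : {set 'I_n} | (#|A| == m) && (i \notin A)]| = 'C(n.-1, m).
Proof.
have -> : n.-1 = #|[set~ i]| by rewrite cardsC1 card_ord.
rewrite -cards_draws cardsE; apply: eq_card => A.
rewrite !inE andbC; congr (_ && _); apply/idP/fintype.subsetP => [iA x xA|sA].
  by rewrite !inE; apply: contraNneq iA => <-.
by apply/negP => /sA; rewrite !inE eqxx.
Qed.

Lemma sum_sets_avoiding m (F : 'I_n -> V) :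
  \sum_(A : {set 'I_n} | #|A| == m) \sum_(i | i \notin A) F i =
  (\sum_i F i) *+ 'C(n.-1, m).
Proof.
rewrite (exchange_big_dep predT) //= -sumrMnl; apply: eq_bigr => i _.
by rewrite sumr_const card_sets_avoiding.
Qed.

(** For fixed i, the involution J |-> J^c \ i exchanges the sets of size n - k and those of size k -
    1 that avoid i. *)
Lemma sum_sets_complement k (F : {set 'I_n} -> 'I_n -> V) : (0 < k <= n)%N ->
  \sum_(J : {set 'I_n} | #|J| == (n - k)%N) \sum_(i | i \notin J) F (~: J :\ i) i =
  \sum_(I : {set 'I_n} | #|I| == k.-1) \sum_(i | i \notin I) F I i.
Proof.
move=> /andP[k0 kn].
rewrite (exchange_big_dep predT) //= [RHS](exchange_big_dep predT) //=.
apply: eq_bigr => i _.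
rewrite [RHS](reindex_onto (fun J => ~: J :\ i) (fun J => ~: J :\ i)) /=; last first.
  move=> I /andP[_ iI]; apply/setP => x; rewrite !inE.
  by case: eqVneq => [->|_] /=; rewrite ?negbK ?(negbTE iI).
apply: eq_bigl => J; rewrite !inE eqxx /= andbT.
have -> : (~: (~: J :\ i) :\ i == J) = (i \notin J).
  apply/eqP/idP => [<-|iJ]; first by rewrite !inE eqxx.
  by apply/setP => x; rewrite !inE; case: eqVneq => [->|_] /=; rewrite ?negbK ?(negbTE iJ).
have [iJ|] := boolP (i \in J); first by rewrite !andbF.
rewrite !andbT => iJ.
have := cardsC J; rewrite card_ord (cardsD1 i (~: J)) inE iJ /= => nE.
by move: #|_ :\ _| #|J| nE => a b nE; apply/eqP/eqP; lia.
Qed.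

End SubsetSums.

(** * Comparison of the norms of (X_i) in H_n^k, R_n and C_n *)

Section Bounds.
Variables (R : realType) (n N : nat).
Local Notation C := R[i].
Implicit Types (X : 'I_n -> 'M[C]_N) (c : R).

(** In b_i the set I is determined by J and i as J^c \ i, so the sign depends on J and i alone. *)
Definition esgn (J : {set 'I_n}) (i : 'I_n) : C := signature R (~: J :\ i) i J.

Lemma esgn_sqr (J : {set 'I_n}) i : i \notin J -> esgn J i ^+ 2 = 1.
Proof.
move=> iJ; apply: signature_sqr.
  by rewrite disjoint_subset; apply/fintype.subsetP => x; rewrite !inE => /andP[].
apply/setP => x; rewrite !inE; case: eqVneq => [->|_] /=; first by rewrite iJ.
by rewrite orNb.
Qed.

Lemma abs2_esgn (J : {set 'I_n}) i : i \notin J -> abs2 (esgn J i) = 1.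
Proof.
move=> /esgn_sqr /(congr1 (@abs2 R)); rewrite expr2 abs2M abs2_1 => e2.
apply/eqP; rewrite -(@eqrXn2 _ 2) ?abs2_ge0 ?ler01 //.
by rewrite expr1n expr2 e2.
Qed.

Lemma nsq_esgn (J : {set 'I_n}) i (v : 'cV[C]_N) :
  i \notin J -> nsq (esgn J i *: v) = nsq v.
Proof. by move=> iJ; rewrite nsqZ abs2_esgn // mul1r. Qed.

(** For J of size n - k, this is the component at J of the operator sum_i X_i (x) b_i applied to
    h. *)
Definition Hnk_action X (h : {set 'I_n} -> 'cV[C]_N) (J : {set 'I_n}) : 'cV[C]_N :=
  \sum_(i | i \notin J) esgn J i *: (X i *m h (~: J :\ i)).

(* For c >= 0, these say that the square of the norm of sum_i X_i (x) b_i
   is at most c in M_N(H_n^k), in M_N(R_n) and in M_N(C_n) respectively. *)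
Definition Hnk_bounded k X c := forall h : {set 'I_n} -> 'cV[C]_N,
  \sum_(J : {set 'I_n} | #|J| == (n - k)%N) nsq (Hnk_action X h J) <=
  c * \sum_(I : {set 'I_n} | #|I| == k.-1) nsq (h I).

Definition row_bounded X c := forall g : 'I_n -> 'cV[C]_N,
  nsq (\sum_i X i *m g i) <= c * \sum_i nsq (g i).

Definition col_bounded X c := forall v : 'cV[C]_N,
  \sum_i nsq (X i *m v) <= c * nsq v.

Lemma card_notin (J : {set 'I_n}) : #|[pred i | i \notin J]| = (n - #|J|)%N.
Proof.
have <- : #|~: J| = (n - #|J|)%N by rewrite finset.cardsCs finset.setCK card_ord.
by apply: eq_card => i; rewrite !inE.
Qed.

(** The removed index is the only element of J^c missing from the set. *)
Lemma setC_D1_inj (J : {set 'I_n}) i j :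
  i \notin J -> j \notin J -> ~: J :\ i = ~: J :\ j -> i = j.
Proof.
move=> iJ jJ /setP /(_ i); rewrite !inE eqxx iJ /= andbT.
by move/esym/negbT; rewrite negbK => /eqP.
Qed.

Section Fixed.
Variables (k : nat) (hk : (0 < k <= n)%N).
Let kn : (k <= n)%N. Proof. by case/andP: hk. Qed.
Let k0 : (0 < k)%N. Proof. by case/andP: hk. Qed.

(** For each J the row bound is applied to the signed vectors h(J^c \ i), extended by 0 to i in J.
    Summed over J, each h(I) occurs once for every i outside I, that is n - k + 1 times. *)
Lemma row_Hnk_bounded X c : 0 <= c ->
  row_bounded X c -> Hnk_bounded k X ((n - k).+1%:R * c).
Proof.
move=> c0 Xc h.
apply: (@le_trans _ _ (\sum_(J : {set 'I_n} | #|J| == (n - k)%N)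
    (c * \sum_(i | i \notin J) nsq (h (~: J :\ i))))).
  apply: ler_sum => J _.
  have := Xc (fun i => if i \notin J then esgn J i *: h (~: J :\ i) else 0).
  rewrite [X in nsq X](bigID (fun i => i \notin J)) /= [X in nsq (_ + X)]big1 ?addr0; last first.
    by move=> i /negbTE ->; rewrite mulmx0.
  rewrite [X in _ <= _ * X](bigID (fun i => i \notin J)) /= [X in _ <= _ * (_ + X)]big1 ?addr0; last first.
    by move=> i /negbTE ->; rewrite nsq0.
  rewrite (eq_bigr (fun i => esgn J i *: (X i *m h (~: J :\ i)))); last first.
    by move=> i ->; rewrite -scalemxAr.
  move=> /le_trans; apply; rewrite ler_wpM2l // ler_sum // => i iJ.
  by rewrite iJ nsq_esgn.
rewrite -mulr_sumr (@sum_sets_complement _ _ k (fun I _ => nsq (h I))) //.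
rewrite mulrAC [leRHS]mulrC ler_wpM2l // mulr_sumr ler_sum // => I /eqP cI.
rewrite sumr_const card_notin cI -[leLHS]mulr_natl ler_wpM2r ?nsq_ge0 // ler_nat; lia.
Qed.

(** Each component at J is a sum of k vectors, and Cauchy-Schwarz costs the factor k. Regrouped by
    I, the terms for I are part of the column sum at the vector h(I). *)
Lemma col_Hnk_bounded X c :
  col_bounded X c -> Hnk_bounded k X (k%:R * c).
Proof.
move=> Xc h.
apply: (@le_trans _ _ (\sum_(J : {set 'I_n} | #|J| == (n - k)%N)
    (k%:R * \sum_(i | i \notin J) nsq (X i *m h (~: J :\ i))))).
  apply: ler_sum => J /eqP cJ; apply: le_trans (nsq_sum_le _ _) _.
  rewrite card_notin cJ subKn // ler_wpM2l // ler_sum // => i iJ.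
  by rewrite nsq_esgn.
rewrite -mulr_sumr (@sum_sets_complement _ _ k (fun I i => nsq (X i *m h I))) //.
rewrite -mulrA ler_wpM2l // mulr_sumr ler_sum // => I _.
apply: le_trans (Xc _); rewrite [leRHS](bigID (fun i => i \notin I)) /= lerDl.
by apply: sumr_ge0 => i _; exact: nsq_ge0.
Qed.

(* Testing on the vectors supported on a single I, then summing over I. *)
Lemma Hnk_col_bounded X c :
  Hnk_bounded k X c -> col_bounded X (n%:R / (n - k).+1%:R * c).
Proof.
move=> Xc v.
have XI (I : {set 'I_n}) : #|I| == k.-1 ->
    \sum_(i | i \notin I) nsq (X i *m v) <= c * nsq v.
  move=> cI; pose h (J : {set 'I_n}) := if J == I then v else 0.
  have := Xc h; rewrite [X in _ <= _ * X](bigD1 I cI) /= [X in _ + X]big1; last first.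
    by move=> J /andP[_ /negbTE JI]; rewrite /h JI nsq0.
  rewrite addr0 {2}/h eqxx; apply: le_trans.
  rewrite (eq_bigr (fun J : {set 'I_n} => \sum_(i | i \notin J) nsq (X i *m h (~: J :\ i)))); last first.
    (* As h is supported on I, at most one i contributes to the component at J. *)
    move=> J _; rewrite nsq_sum_single; first by apply: eq_bigr => i iJ; rewrite nsq_esgn.
    have supp i : esgn J i *: (X i *m h (~: J :\ i)) != 0 -> ~: J :\ i = I.
      by apply: contraNeq => /negbTE JI; rewrite /h JI mulmx0 scaler0.
    by move=> i j iJ jJ /supp iI /supp jI; apply: (setC_D1_inj iJ jJ); rewrite iI jI.
  rewrite (@sum_sets_complement _ _ k (fun I i => nsq (X i *m h I))) //.
  rewrite (bigD1 I cI) /= /h eqxx lerDl.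
  by do 2!apply: sumr_ge0 => ? _; exact: nsq_ge0.
have := ler_sum (index_enum _) XI.
rewrite sum_sets_avoiding sumr_const -[leLHS]mulr_natl -[leRHS]mulr_natl.
have -> : #|(fun I : {set 'I_n} => #|I| == k.-1)| = 'C(n, k.-1).
  by rewrite -cardsE card_draws card_ord.
(* There are C(n, k-1) sets I, and each i is avoided by C(n-1, k-1) of them; the quotient is the
   constant n / (n - k + 1). *)
have E : n%:R * 'C(n.-1, k.-1)%:R = (n - k).+1%:R * 'C(n, k.-1)%:R :> R.
  by rewrite -!natrM mul_bin_down; congr (_ * _)%:R; lia.
have B0 : (0 : R) < 'C(n.-1, k.-1)%:R by rewrite ltr0n bin_gt0; lia.
set S := \sum_i _; set B := 'C(n.-1, k.-1)%:R in E B0 *; set D := 'C(n, k.-1)%:R in E *.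
move=> BS; rewrite -[leRHS]mulrA mulrAC ler_pdivlMr ?ltr0Sn //.
rewrite -(ler_pM2l B0).
have := ler_wpM2l (ler0n R (n - k).+1) BS.
by rewrite [X in _ <= X]mulrA -E; move=> h; nra.
Qed.

(* Testing, for each J, on the vectors h_{J^c \ i} = +- g_i, then summing over J. *)
Lemma Hnk_row_bounded X c : 0 <= c ->
  Hnk_bounded k X c -> row_bounded X (n%:R / k%:R * c).
Proof.
move=> c0 Xc g.
have XJ (J : {set 'I_n}) : #|J| == (n - k)%N ->
    nsq (\sum_(i | i \notin J) X i *m g i) <= c * \sum_(i | i \notin J) nsq (g i).
  move=> cJ.
  (* This sum has at most one term for each I, and is 0 when I is not of the form J^c \ i. *)
  pose h (I : {set 'I_n}) := \sum_(i | (i \notin J) && (~: J :\ i == I)) esgn J i *: g i.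
  have hE i : i \notin J -> h (~: J :\ i) = esgn J i *: g i.
    move=> iJ; rewrite /h (big_pred1 i) // => j /=.
    apply/andP/eqP => [[jJ /eqP]|->]; last by rewrite iJ eqxx.
    exact: setC_D1_inj.
  apply: (@le_trans _ _ (\sum_(J : {set 'I_n} | #|J| == (n - k)%N) nsq (Hnk_action X h J))).
    rewrite (bigD1 J cJ) /= /Hnk_action.
    rewrite [X in _ <= nsq X + _](eq_bigr (fun i => X i *m g i)); last first.
      (* The sign put into h cancels the sign of b_i. *)
      by move=> i iJ; rewrite hE // -scalemxAr scalerA -expr2 esgn_sqr // scale1r.
    by rewrite lerDl sumr_ge0 // => ? _; exact: nsq_ge0.
  apply: le_trans (Xc h) _; rewrite ler_wpM2l //.
  rewrite [leLHS](eq_bigr (fun I => \sum_(i | (i \notin J) && (~: J :\ i == I)) nsq (g i))).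
    rewrite (exchange_big_dep (fun i => i \notin J)) /=; last by move=> I i _ /andP[].
    apply: ler_sum => i iJ.
    rewrite sumr_const -[leLHS]mulr_natl ler_piMl ?nsq_ge0 // (_ : 1 = 1%:R) // ler_nat.
    rewrite -(card1 (~: J :\ i)); apply: subset_leq_card; apply/fintype.subsetP => I.
    by rewrite !inE => /andP[_ /andP[_ /eqP ->]].
  move=> I _; rewrite nsq_sum_single; first by apply: eq_bigr => i /andP[iJ _]; rewrite nsq_esgn.
  by move=> i j /andP[iJ /eqP iI] /andP[jJ /eqP jI] _ _; apply: (setC_D1_inj iJ jJ); rewrite iI.
have cardJ : #|(fun J : {set 'I_n} => #|J| == (n - k)%N)| = 'C(n, k).
  by rewrite -cardsE card_draws card_ord bin_sub.
have := ler_sum (index_enum _) XJ.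
rewrite -mulr_sumr sum_sets_avoiding => XS.
(* Summing the vectors over J gives C(n-1, k-1) times the full row sum, at the cost of a factor C(n,
   k). The quotient of these numbers yields n / k. *)
have := nsq_sum_le (fun J : {set 'I_n} => #|J| == (n - k)%N)
  (fun J : {set 'I_n} => \sum_(i | i \notin J) X i *m g i).
rewrite sum_sets_avoiding cardJ -scaler_nat nsqZ abs2_nat => XT.
have binE : 'C(n.-1, n - k) = 'C(n.-1, k.-1).
  by rewrite -bin_sub; [congr 'C(_, _); lia | lia].
rewrite binE -mulr_natl in XS; rewrite binE in XT.
have E : n%:R * 'C(n.-1, k.-1)%:R = k%:R * 'C(n, k)%:R :> R.
  by rewrite -!natrM mul_bin_diag prednK.
have B0 : (0 : R) < 'C(n.-1, k.-1)%:R by rewrite ltr0n bin_gt0; lia.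
have k0R : (0 : R) < k%:R by rewrite ltr0n.
have D0 : (0 : R) <= 'C(n, k)%:R by [].
set S := \sum_i nsq _ in XS *; set T := nsq _ in XT *.
set B := 'C(n.-1, k.-1)%:R in E B0 XS XT *; set D := 'C(n, k)%:R in E D0 XT *.
have {}XT : B ^+ 2 * T <= D * (c * (B * S)) by exact: le_trans XT (ler_wpM2l D0 XS).
have {}XT : B * T <= D * c * S by rewrite -(ler_pM2l B0); move: XT; nra.
rewrite -[leRHS]mulrA mulrAC ler_pdivlMr // -(ler_pM2l B0).
have -> : B * (n%:R * (c * S)) = k%:R * (D * c * S).
  by rewrite mulrA [B * _]mulrC E !mulrA.
by rewrite [leLHS]mulrA [leLHS]mulrC ler_pM2l.
Qed.

End Fixed.
End Bounds.

(** * Coordinates in H_n^k and its matrix norms *)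

Section Hspace.
Variables (R : realType) (n : nat).
Local Notation C := R[i].
Local Notation lexset m b := (nth finset.set0 (lex_subsets n m) b).

Lemma mem_lex_subsets m (A : {set 'I_n}) : (A \in lex_subsets n m) = (#|A| == m).
Proof. by rewrite mem_sort mem_enum inE. Qed.

Lemma size_lex_subsets m : size (lex_subsets n m) = 'C(n, m).
Proof. by rewrite size_sort -cardE card_draws card_ord. Qed.

Lemma uniq_lex_subsets m : uniq (lex_subsets n m).
Proof. by rewrite sort_uniq enum_uniq. Qed.

Lemma card_lexset m (a : 'I_('C(n, m))) : #|lexset m a| = m.
Proof. by apply/eqP; rewrite -mem_lex_subsets mem_nth // size_lex_subsets. Qed.

Lemma lexset_onto m (A : {set 'I_n}) : #|A| = m -> exists a : 'I_('C(n, m)), lexset m a = A.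
Proof.
move=> /eqP; rewrite -mem_lex_subsets => Am.
have ltA : (index A (lex_subsets n m) < 'C(n, m))%N by rewrite -size_lex_subsets index_mem.
by exists (Ordinal ltA); rewrite nth_index.
Qed.

Lemma lexset_inj m : injective (fun a : 'I_('C(n, m)) => lexset m a).
Proof.
move=> a b /eqP; rewrite nth_uniq ?size_lex_subsets ?uniq_lex_subsets // => /eqP ab.
exact: val_inj.
Qed.

(** The list is a permutation of the sets of cardinality m, and a sum is insensitive to the
    order. *)
Lemma sum_lexset (V : nmodType) m (F : {set 'I_n} -> V) :
  \sum_(b < 'C(n, m)) F (lexset m b) = \sum_(A : {set 'I_n} | #|A| == m) F A.
Proof.
rewrite -(big_mkord predT (fun b => F (lexset m b))) -size_lex_subsets -(big_nth _ predT).
rewrite (perm_big (enum [set A : {set 'I_n} | #|A| == m])) /=; last first.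
  by apply/permPl; exact: perm_sort.
by rewrite big_enum /=; apply: eq_bigl => A; rewrite inE.
Qed.

(** The two conditions on I and J in [bvec] together say that i is outside J and I = J^c \ i. *)
Lemma bvecE k i (a : 'I_('C(n, n - k))) (b : 'I_('C(n, k.-1))) :
  bvec R k i a b = let J := lexset (n - k) a in
    if (i \notin J) && (~: J :\ i == lexset k.-1 b) then esgn R J i else 0.
Proof.
rewrite /bvec summxE (bigD1 a) //= [X in _ + X]big1 ?addr0; last first.
  move=> a' a'a; rewrite summxE big1 // => b' _.
  by case: ifP => _; rewrite !mxE // eq_sym (negbTE a'a) mulr0.
rewrite summxE (bigD1 b) //= [X in _ + X]big1 ?addr0; last first.
  move=> b' b'b.
  by case: ifP => _; rewrite !mxE // [b == _]eq_sym (negbTE b'b) andbF mulr0.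
set J := lexset _ a; set I := lexset _ b.
have -> : (I :&: J == finset.set0) && (~: (I :|: J) == [set i]%SET) =
          (i \notin J) && (~: J :\ i == I).
  apply/andP/andP => [[/eqP dIJ /eqP cIJ]|[iJ /eqP <-]].
    split.
      have : i \in ~: (I :|: J) by rewrite cIJ !inE.
      by rewrite !inE negb_or => /andP[].
    apply/eqP/setP => x; move/setP/(_ x): cIJ; move/setP/(_ x): dIJ; rewrite !inE.
    by case: (x \in I); case: (x \in J) => //= _; case: (x == i).
  split; apply/eqP/setP => x; rewrite !inE; first by case: (x \in J); rewrite ?andbF.
  by case: eqVneq => [->|]; rewrite ?(negbTE iJ) //= orNb.
case: ifP => [/andP[_ /eqP E]|_]; rewrite !mxE //.
by rewrite !eqxx mulr1 /esgn E.
Qed.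

Section Fixed.
Variables (k : nat) (hk : (0 < k <= n)%N).

(** Row J of b_i has at most one nonzero entry, in column J^c \ i; this set has k - 1 elements, so
    it does index a column. *)
Lemma sum_bvec i (a : 'I_('C(n, n - k))) (G : {set 'I_n} -> C) :
  \sum_b bvec R k i a b * G (lexset k.-1 b) =
  let J := lexset (n - k) a in if i \notin J then esgn R J i * G (~: J :\ i) else 0.
Proof.
set J := lexset _ a => /=.
under eq_bigr do rewrite bvecE -/J.
rewrite (sum_lexset _ (fun I => (if (i \notin J) && (~: J :\ i == I) then esgn R J i else 0) * G I)).
have cJ : #|J| = (n - k)%N by exact: card_lexset.
have [iJ|iJ] /= := ifPn; last by rewrite big1 // => I _; rewrite mul0r.
have cI : #|~: J :\ i| == k.-1.
  have := cardsC J; rewrite card_ord (cardsD1 i (~: J)) inE iJ /= cJ.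
  by move: #|_ :\ _| => c cE; apply/eqP; lia.
rewrite (bigD1 _ cI) /= eqxx big1 ?addr0 // => I /andP[_ ne].
by rewrite eq_sym (negbTE ne) mul0r.
Qed.

Definition bvecs : n.-tuple 'M[C]_('C(n, n - k), 'C(n, k.-1)) :=
  [tuple bvec R k i | i < n].

Lemma bvecs_codom : codom (bvec R k) = bvecs.
Proof. by rewrite /= codomE. Qed.

Lemma bvecs_nth (i : 'I_n) : bvecs`_i = bvec R k i.
Proof. by rewrite -tnth_nth tnth_mktuple. Qed.

(** For J avoiding i, the entry at (J, J^c \ i) is nonzero in b_i alone, so it isolates the i-th
    coefficient up to sign. *)
Lemma free_bvecs : free bvecs.
Proof.
apply/freeP => c c0 i.
(* Such a J exists because C(n-1, n-k) is positive. *)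
have [J /andP[/= /eqP cJ iJ]] :
    exists J, [pred A : {set 'I_n} | (#|A| == (n - k)%N) && (i \notin A)] J.
  by apply/card_gt0P; rewrite card_sets_avoiding bin_gt0; lia.
have [a aJ] := lexset_onto cJ.
have : \sum_b (\sum_j c j *: bvecs`_j) a b * (lexset k.-1 b == ~: J :\ i)%:R = 0.
  by rewrite c0 big1 // => b _; rewrite mxE mul0r.
under eq_bigr do rewrite summxE mulr_suml.
rewrite exchange_big (bigD1 i) //= [X in _ + X]big1 ?addr0; last first.
  move=> j ji; under eq_bigr do rewrite bvecs_nth mxE -mulrA.
  rewrite -mulr_sumr (sum_bvec _ _ (fun I => (I == ~: J :\ i)%:R)) /= aJ.
  case: ifP => [jJ|_]; last by rewrite mulr0.
  case: eqP => [/(setC_D1_inj jJ iJ) /eqP|_]; first by rewrite (negbTE ji).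
  by rewrite !mulr0.
under eq_bigr do rewrite bvecs_nth mxE -mulrA.
rewrite -mulr_sumr (sum_bvec _ _ (fun I => (I == ~: J :\ i)%:R)) /= aJ iJ eqxx mulr1.
move=> /(congr1 ( *%R^~ (esgn R J i))).
by rewrite -mulrA -expr2 esgn_sqr // mulr1 mul0r.
Qed.

Lemma osdim_Hspace : osdim (Hspace R n k) = n.
Proof.
rewrite /osdim dimvf /dim /=.
have := free_bvecs; rewrite /free -bvecs_codom => /eqP ->.
by rewrite bvecs_codom size_tuple.
Qed.

Definition hbasis (i : 'I_n) : Hspace R n k := vsproj <<codom (bvec R k)>>%VS (bvec R k i).

Definition hcoord (i : 'I_n) (x : Hspace R n k) : C := coord bvecs i (vsval x).

Fact hcoord_linear i : scalar (hcoord i).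
Proof. by move=> a x y; rewrite /hcoord !linearP. Qed.

HB.instance Definition _ i := GRing.isLinear.Build C (Hspace R n k) C *%R (hcoord i)
  (hcoord_linear i).

Lemma vsval_hcoord (x : Hspace R n k) : vsval x = \sum_i hcoord i x *: bvec R k i.
Proof.
have : vsval x \in <<bvecs>>%VS by rewrite -bvecs_codom; exact: subvsP.
by move=> /coord_span {1}->; apply: eq_bigr => i _; rewrite bvecs_nth.
Qed.

Lemma vsval_hbasis i : vsval (hbasis i) = bvec R k i.
Proof. by rewrite vsprojK // memv_span // codom_f. Qed.

Lemma hcoord_sum (x : Hspace R n k) : x = \sum_i hcoord i x *: hbasis i.
Proof.
apply: val_inj; rewrite [LHS]vsval_hcoord linear_sum; apply: eq_bigr => i _.
by rewrite linearZ /= vsval_hbasis.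
Qed.

Lemma hcoord_basis i j : hcoord i (hbasis j) = (i == j)%:R.
Proof. by rewrite /hcoord vsval_hbasis -bvecs_nth (coord_free _ _ free_bvecs) eq_sym. Qed.

Lemma hcoord_lincomb i (c : 'I_n -> C) : hcoord i (\sum_j c j *: hbasis j) = c i.
Proof.
rewrite linear_sum (bigD1 i) //= linearZ /= hcoord_basis eqxx mulr1 big1 ?addr0 // => j ji.
by rewrite linearZ /= hcoord_basis eq_sym (negbTE ji) mulr0.
Qed.

Definition hcoord_mx N (x : 'M[Hspace R n k]_N) (i : 'I_n) : 'M[C]_N := map_mx (hcoord i) x.

(** Exchanges the two tensor factors: vectors of C^N indexed by sets become N vectors indexed by
    lexicographic positions. *)
Definition of_sets m N (h : {set 'I_n} -> 'cV[C]_N) (j : 'I_N) : cV_hilbert R 'C(n, m) :=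
  \col_b h (lexset m b) j 0.

Lemma of_sets_onto m N (h : 'I_N -> cV_hilbert R 'C(n, m)) : exists g, h = of_sets m g.
Proof.
exists (fun A => \col_j if [pick a : 'I_('C(n, m)) | lexset m a == A] is Some a
                        then (h j : 'cV[C]_('C(n, m))) a 0 else 0).
apply/funext => j; apply/matrixP => a b; rewrite ord1 !mxE.
by case: pickP => [a' /eqP /lexset_inj -> //|/(_ a)]; rewrite eqxx.
Qed.

Lemma hnormN_of_sets m N (h : {set 'I_n} -> 'cV[C]_N) :
  hnormN (of_sets m h) = Num.sqrt (\sum_(A : {set 'I_n} | #|A| == m) nsq (h A)).
Proof.
rewrite /hnormN -sum_lexset exchange_big /=; congr Num.sqrt; apply: eq_bigr => j _.
rewrite /hnorm dot_norm_cVdot sqr_sqrtr; last by apply: sumr_ge0 => ? _; exact: sqr_ge0.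
by apply: eq_bigr => b _; rewrite mxE.
Qed.

(** Each entry of x is expanded in the b_i, and each row of b_i is evaluated by [sum_bvec]. *)
Lemma opN_of_sets N (x : 'M[Hspace R n k]_N) (h : {set 'I_n} -> 'cV[C]_N) :
  opN x (of_sets k.-1 h) = of_sets (n - k) (Hnk_action (hcoord_mx x) h).
Proof.
apply/funext => r; apply/matrixP => a z; rewrite ord1 {z} /opN summxE mxE /Hnk_action summxE.
set J := lexset _ a.
under eq_bigr => j _.
  rewrite mxE; under eq_bigr => b _ do rewrite vsval_hcoord summxE mulr_suml.
  rewrite exchange_big /=; under eq_bigr => i _.
    under eq_bigr do rewrite !mxE -mulrA.
    rewrite -mulr_sumr (sum_bvec _ _ (fun I => h I j 0)) /= -/J; over.
  over.
rewrite exchange_big /= [RHS]big_mkcond /=; apply: eq_bigr => i _.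
case: ifP => _; last by rewrite big1 // => j _; rewrite mulr0.
rewrite !mxE mulr_sumr; apply: eq_bigr => j _.
by rewrite !mxE mulrCA.
Qed.

(** The bridge between operator norms and the squared inequalities; it is complete because every
    test vector is of the form [of_sets]. *)
Lemma mxnorm_Hspace_leP N (x : 'M[Hspace R n k]_N) (c : R) : 0 <= c ->
  (mxnorm x <= (Num.sqrt c)%:E)%E <-> Hnk_bounded k (hcoord_mx x) c.
Proof.
move=> c0; have sum_ge0 m (g : {set 'I_n} -> 'cV[C]_N) :
    0 <= \sum_(A : {set 'I_n} | #|A| == m) nsq (g A).
  by apply: sumr_ge0 => A _; exact: nsq_ge0.
split=> [/(mxnorm_leP _ (sqrtr_ge0 c)) xc h|xc].
  have := xc (of_sets k.-1 h); rewrite opN_of_sets !hnormN_of_sets -sqrtrM //.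
  by rewrite ler_sqrt // mulr_ge0.
apply/(mxnorm_leP _ (sqrtr_ge0 c)) => h; have [g ->] := of_sets_onto h.
by rewrite opN_of_sets !hnormN_of_sets -sqrtrM // ler_wsqrtr.
Qed.

End Fixed.
End Hspace.

(** * The maps b_i |-> b_i and the upper bounds for the distances *)

Section Distances.
Variables (R : realType) (n : nat).
Local Notation C := R[i].

Section Transfer.
Variables (k m : nat).

Definition htransfer_fun (x : Hspace R n k) : Hspace R n m :=
  \sum_i hcoord i x *: hbasis R m i.

Fact htransfer_linear : linear htransfer_fun.
Proof.
move=> a x y; rewrite /htransfer_fun scaler_sumr -big_split /=; apply: eq_bigr => i _.
by rewrite linearP /= scalerDl scalerA.
Qed.

HB.instance Definition _ := GRing.isLinear.Build C (Hspace R n k) (Hspace R n m) *:%R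
  htransfer_fun htransfer_linear.

Definition htransfer : 'Hom(Hspace R n k, Hspace R n m) := linfun htransfer_fun.

Lemma htransferE x : htransfer x = \sum_i hcoord i x *: hbasis R m i.
Proof. by rewrite lfunE. Qed.

(** The map keeps the coordinate matrices X_i, so only the bounds for the same family in the two
    spaces are compared. *)
Lemma cbnorm_htransfer (c : R) : (0 < k <= n)%N -> (0 < m <= n)%N -> 0 <= c ->
  (forall N (X : 'I_n -> 'M[C]_N), Hnk_bounded k X 1 -> Hnk_bounded m X c) ->
  (cbnorm htransfer <= (Num.sqrt c)%:E)%E.
Proof.
move=> hk hm c0 kmc; apply: cbnorm_le => N x.
rewrite -{1}sqrtr1 => /(mxnorm_Hspace_leP hk _ ler01) /kmc xc.
apply/(mxnorm_Hspace_leP hm _ c0) => h.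
rewrite (_ : hcoord_mx _ = hcoord_mx x) //.
apply/funext => i; apply/matrixP => a b.
by rewrite !mxE htransferE hcoord_lincomb.
Qed.

End Transfer.

Lemma htransferK k m : (0 < m <= n)%N -> cancel (htransfer k m) (htransfer m k).
Proof.
move=> hm x; rewrite htransferE [RHS]hcoord_sum; apply: eq_bigr => i _.
by rewrite htransferE hcoord_lincomb.
Qed.

Section UpperBounds.
Variables (k : nat) (hk : (0 < k <= n)%N).
Let n0 : (0 < n)%N. Proof. by case/andP: hk; exact: leq_trans. Qed.
Let hn : (0 < n <= n)%N. Proof. by rewrite n0 leqnn. Qed.
Let h1 : (0 < 1 <= n)%N. Proof. by []. Qed.
Let nn1 : n%:R / n%:R = 1 :> R. Proof. by rewrite divff // pnatr_eq0 -lt0n. Qed.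

(** For k = n both comparisons with R_n have constant 1, so each direction passes through
    [row_bounded] and only the constant for k remains. *)
Lemma dcb_Hnk_row :
  (dcb (Hspace R n k) (Hspace R n n) <=
     (Num.sqrt (n%:R / k%:R) * Num.sqrt (n - k).+1%:R)%:E)%E.
Proof.
apply: (dcb_le (htransferK hn) (htransferK hk)).
  apply: cbnorm_htransfer => //.
  move=> N X /(Hnk_row_bounded hk ler01) Xr.
  by have := row_Hnk_bounded hn _ Xr; rewrite subnn mul1r mulr1; apply; rewrite divr_ge0.
apply: cbnorm_htransfer => // N X /(Hnk_row_bounded hn ler01).
by rewrite nn1 mulr1 => /(row_Hnk_bounded hk ler01); rewrite mulr1.
Qed.

(** Likewise, for k = 1 both comparisons with C_n have constant 1. *)
Lemma dcb_Hnk_col :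
  (dcb (Hspace R n k) (Hspace R n 1) <=
     (Num.sqrt (n%:R / (n - k).+1%:R) * Num.sqrt k%:R)%:E)%E.
Proof.
apply: (dcb_le (htransferK h1) (htransferK hk)).
  apply: cbnorm_htransfer => //.
  move=> N X /(Hnk_col_bounded hk) /(col_Hnk_bounded h1).
  by rewrite mul1r mulr1.
apply: cbnorm_htransfer => // N X /(Hnk_col_bounded h1).
by rewrite subn1 prednK // nn1 mulr1 => /(col_Hnk_bounded hk); rewrite mulr1.
Qed.

End UpperBounds.

(** * The lower bound n for the product of the distances to R_n and C_n *)

Section LowerBound.
Hypothesis n0 : (0 < n)%N.
Let hn : (0 < n <= n)%N. Proof. by rewrite n0 leqnn. Qed.
Let h1 : (0 < 1 <= n)%N. Proof. by []. Qed.
Let i0 : 'I_n := Ordinal n0.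
Let nn1 : n%:R / n%:R = 1 :> R. Proof. by rewrite divff // pnatr_eq0 -lt0n. Qed.

(* Testing on the column (b_1, ..., b_n)^t, of norm 1 in M_n(R_n). *)
Lemma hilbert_schmidt_row_col (T : 'Hom(Hspace R n n, Hspace R n 1)) (a : R) :
  (cbnorm T <= a%:E)%E ->
  \sum_l \sum_i abs2 (hcoord i (T (hbasis R n l))) <= a ^+ 2.
Proof.
move=> Ta; have a0 : 0 <= a by rewrite -lee_fin (le_trans (cbnorm_ge0 T)).
pose x : 'M[Hspace R n n]_n := \matrix_(r, s) if s == i0 then hbasis R n r else 0.
have x1 : (mxnorm x <= 1%:E)%E.
  rewrite -sqrtr1; apply/(mxnorm_Hspace_leP hn _ ler01).
  rewrite (_ : 1 = (n - n).+1%:R * 1); last by rewrite subnn mulr1.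
  apply: row_Hnk_bounded => // g; rewrite mul1r.
  apply: ler_sum => r _; rewrite summxE (bigD1 r) //= big1 ?addr0; last first.
    move=> l lr; rewrite mxE big1 // => s _; rewrite !mxE.
    case: eqP => _; last by rewrite linear0 mul0r.
    by rewrite hcoord_basis // (negbTE lr) mul0r.
  rewrite mxE (bigD1 i0) //= big1 ?addr0; last first.
    by move=> s /negbTE si; rewrite !mxE si linear0 mul0r.
  rewrite !mxE eqxx hcoord_basis // eqxx mul1r.
  rewrite /nsq (bigD1 i0) //= lerDl.
  by apply: sumr_ge0 => s _; exact: abs2_ge0.
have := mxnorm_map_le Ta ler01 x1.
rewrite mulr1 -{1}(ger0_norm a0) -sqrtr_sqr.
move=> /(mxnorm_Hspace_leP h1 _ (sqr_ge0 a)) /(Hnk_col_bounded h1).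
(* The factor n / (n - k + 1) is 1 for k = 1. The basis vector selects the column that carries the
   T(b_r). *)
rewrite subn1 prednK // nn1 mul1r => /(_ (delta_mx i0 0)).
rewrite (_ : nsq _ = 1) ?mulr1; last first.
  rewrite /nsq (bigD1 i0) //= big1 ?addr0 ?mxE ?eqxx ?abs2_1 // => s /negbTE si.
  by rewrite mxE si abs2_0.
congr (_ <= _); rewrite exchange_big; apply: eq_bigr => i _ /=.
by apply: eq_bigr => r _; rewrite -colE !mxE eqxx.
Qed.

(* Testing on the row (b_1, ..., b_n), of norm 1 in M_n(C_n). *)
Lemma hilbert_schmidt_col_row (S : 'Hom(Hspace R n 1, Hspace R n n)) (b : R) :
  (cbnorm S <= b%:E)%E ->
  \sum_l \sum_i abs2 (hcoord l (S (hbasis R 1 i))) <= b ^+ 2.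
Proof.
move=> Sb; have b0 : 0 <= b by rewrite -lee_fin (le_trans (cbnorm_ge0 S)).
pose x : 'M[Hspace R n 1]_n := \matrix_(r, s) if r == i0 then hbasis R 1 s else 0.
have x1 : (mxnorm x <= 1%:E)%E.
  rewrite -sqrtr1; apply/(mxnorm_Hspace_leP h1 _ ler01).
  rewrite (_ : 1 = 1%:R * 1); last by rewrite mulr1.
  apply: col_Hnk_bounded => // v; rewrite mul1r.
  apply: ler_sum => i _; rewrite /nsq (bigD1 i0) //= [X in _ + X]big1 ?addr0; last first.
    move=> r /negbTE ri; rewrite mxE big1 ?abs2_0 // => s _.
    by rewrite !mxE ri linear0 mul0r.
  rewrite mxE (bigD1 i) //= big1 ?addr0; last first.
    by move=> s si; rewrite !mxE eqxx hcoord_basis // eq_sym (negbTE si) mul0r.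
  by rewrite !mxE eqxx hcoord_basis // eqxx mul1r.
have := mxnorm_map_le Sb ler01 x1.
rewrite mulr1 -{1}(ger0_norm b0) -sqrtr_sqr.
move=> /(mxnorm_Hspace_leP hn _ (sqr_ge0 b)) /(Hnk_row_bounded hn (sqr_ge0 b)).
pose s l i := hcoord l (S (hbasis R 1 i)).
(* With the conjugate coefficients, entry [i0] of the image and the squared norm of the test family
   both equal [H], whence H^2 <= b^2 H. *)
rewrite nn1 mul1r => /(_ (fun l => \col_i (s l i)^*)).
pose H := \sum_l \sum_i abs2 (s l i); rewrite -[X in _ -> X <= _]/H.
have H0 : 0 <= H by do 2!apply: sumr_ge0 => ? _; exact: abs2_ge0.
rewrite [X in _ <= _ * X -> _](_ : _ = H); last first.
  by apply: eq_bigr => l _; apply: eq_bigr => i _; rewrite mxE abs2_conj.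
rewrite /nsq (bigD1 i0) //= => HS.
have {HS} : H ^+ 2 <= b ^+ 2 * H.
  apply: le_trans HS; rewrite -[leLHS]addr0; apply: lerD; last first.
    by apply: sumr_ge0 => r _; exact: abs2_ge0.
  rewrite summxE (eq_bigr (fun l => (\sum_i abs2 (s l i))%:C%C)); last first.
    move=> l _; rewrite mxE rmorph_sum; apply: eq_bigr => i _.
    by rewrite !mxE eqxx mul_conj_abs2.
  by rewrite -rmorph_sum /abs2 normc_real_complex.
have [->|Hn] := eqVneq H 0; first by rewrite sqr_ge0.
by rewrite expr2 ler_pM2r // lt_def Hn.
Qed.

(** With T = w v and S = u z, the composite S T is the identity of R_n, of trace n; the
    Hilbert-Schmidt norms of T and S are at most c b and a d. *)
Lemma row_col_cbnorm_ge (E : opspace R)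
    (u : 'Hom(E, Hspace R n n)) (v : 'Hom(Hspace R n n, E))
    (w : 'Hom(E, Hspace R n 1)) (z : 'Hom(Hspace R n 1, E)) (a b c d : R) :
  cancel v u -> cancel w z ->
  (cbnorm u <= a%:E)%E -> (cbnorm v <= b%:E)%E ->
  (cbnorm w <= c%:E)%E -> (cbnorm z <= d%:E)%E ->
  n%:R <= (a * b) * (c * d).
Proof.
move=> vK wK ua vb wc zd.
have HT := hilbert_schmidt_row_col (cbnorm_comp vb wc).
have HS := hilbert_schmidt_col_row (cbnorm_comp zd ua).
set T := (w \o v)%VF in HT; set S := (u \o z)%VF in HS.
have ge0 (E' F : opspace R) (f : 'Hom(E', F)) (e : R) : (cbnorm f <= e%:E)%E -> 0 <= e.
  by move=> fe; rewrite -lee_fin (le_trans (cbnorm_ge0 f)).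
have abcd0 : 0 <= (a * b) * (c * d) by rewrite !mulr_ge0 ?(ge0 _ _ _ _ ua)
  ?(ge0 _ _ _ _ vb) ?(ge0 _ _ _ _ wc) ?(ge0 _ _ _ _ zd).
have trE : n%:R = \sum_l \sum_i hcoord i (T (hbasis R n l)) * hcoord l (S (hbasis R 1 i)).
  rewrite -[n in n%:R]card_ord -sumr_const; apply: eq_bigr => l _.
  have : hcoord l (S (T (hbasis R n l))) = 1.
    by rewrite !comp_lfunE wK vK hcoord_basis // eqxx.
  rewrite {1}(hcoord_sum (T _)) !linear_sum => <-; apply: eq_bigr => i _.
  by rewrite !linearZ.
have : abs2 (n%:R : C) <= (a * b * (c * d)) ^+ 2.
  (* Cauchy-Schwarz over the pairs (l, i). *)
  rewrite trE pair_bigA /=; apply: le_trans (abs2_sum_mul_le _ _ _) _.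
  rewrite -(pair_bigA _ (fun l i => abs2 (hcoord i (T (hbasis R n l))))) /=.
  rewrite -(pair_bigA _ (fun l i => abs2 (hcoord l (S (hbasis R 1 i))))) /=.
  rewrite (_ : _ ^+ 2 = (c * b) ^+ 2 * (a * d) ^+ 2); last by ring.
  by apply: ler_pM => //; do 2!apply: sumr_ge0 => ? _; exact: abs2_ge0.
by rewrite abs2_nat ler_pXn2r ?nnegrE.
Qed.

End LowerBound.

(** A finite infimum forces [A] to be nonempty, since the empty set has infimum +oo. An element of
    [A] then excludes y = 0, and division by y is possible. *)
Lemma le_ereal_inf_mul (A : set (\bar R)) (r y : R) : 0 < r -> 0 <= y ->
  ereal_inf A \is a fin_num -> (forall x, A x -> (r%:E <= x * y%:E)%E) ->
  r <= fine (ereal_inf A) * y.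
Proof.
move=> r0 y0 Afin rA; have [x Ax] : exists x, A x.
  apply: contrapT => A0; move: Afin; rewrite (_ : A = classical_sets.set0) ?ereal_inf0 //.
  by apply/seteqP; split=> x // Ax; case: A0; exists x.
have {}y0 : 0 < y.
  rewrite lt_def y0 andbT; apply: contraTneq r0 => yE.
  by have := rA x Ax; rewrite yE mule0 lee_fin -leNgt.
rewrite -ler_pdivrMr // -lee_fin fineK //; apply: le_ereal_inf_tmp => z /rA.
by rewrite EFinM lee_pdivrMr.
Qed.

(** The two infima are taken one after the other, the isomorphism to R_n being fixed during the
    second. *)
Lemma dcb_row_col_ge (E : opspace R) : (0 < n)%N ->
  dcb E (Hspace R n n) \is a fin_num -> dcb E (Hspace R n 1) \is a fin_num ->
  n%:R <= fine (dcb E (Hspace R n n)) * fine (dcb E (Hspace R n 1)).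
Proof.
move=> n0 rfin cfin; have n0R : (0 : R) < n%:R by rewrite ltr0n.
have cbfin (F G : opspace R) (f : 'Hom(F, G)) : completely_bounded f -> cbnorm f \is a fin_num.
  by move=> fb; rewrite ge0_fin_numE // cbnorm_ge0.
apply: (le_ereal_inf_mul n0R _ rfin) => [|_ [[u v] /= [uK vK ub vb] <-]].
  by rewrite -lee_fin fineK // dcb_ge0.
rewrite -(fineK (cbfin _ _ _ ub)) -(fineK (cbfin _ _ _ vb)) -!EFinM lee_fin mulrC.
apply: (le_ereal_inf_mul n0R _ cfin) => [|_ [[w z] /= [wK zK wb zb] <-]].
  by rewrite mulr_ge0 // -lee_fin fineK ?cbfin ?cbnorm_ge0.
rewrite -(fineK (cbfin _ _ _ wb)) -(fineK (cbfin _ _ _ zb)) -!EFinM lee_fin mulrC.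
by apply: (row_col_cbnorm_ge n0 vK wK); rewrite fineK ?cbfin.
Qed.

End Distances.

(** * Exact values and the degenerate triangle *)

Lemma dcb_Hnk_fin (R : realType) (n k : nat) : (0 < k <= n)%N ->
  dcb (Hspace R n k) (Hspace R n n) \is a fin_num /\
  dcb (Hspace R n k) (Hspace R n 1) \is a fin_num.
Proof.
move=> hk; split; rewrite ge0_fin_numE ?dcb_ge0 //.
  by apply: le_lt_trans (dcb_Hnk_row R hk) _; rewrite ltry.
by apply: le_lt_trans (dcb_Hnk_col R hk) _; rewrite ltry.
Qed.

(** The lower bound for E = H_n^k meets the product of the two upper bounds. *)
Lemma dcb_row_mul_col (R : realType) (n k : nat) : (0 < k <= n)%N ->
  fine (dcb (Hspace R n k) (Hspace R n n)) * fine (dcb (Hspace R n k) (Hspace R n 1)) = n%:R.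
Proof.
move=> hk; have [rfin cfin] := dcb_Hnk_fin R hk.
have n0 : (0 < n)%N by case/andP: hk; exact: leq_trans.
apply/eqP; rewrite eq_le dcb_row_col_ge // andbT.
have := dcb_Hnk_row R hk; have := dcb_Hnk_col R hk.
rewrite -{1}(fineK rfin) -{1}(fineK cfin) !lee_fin => c_le r_le.
apply: le_trans (ler_pM _ _ r_le c_le) _; rewrite ?fine_ge0 ?dcb_ge0 //.
rewrite -!sqrtrM ?mulr_ge0 ?divr_ge0 //.
have k0 : (k%:R : R) != 0 by rewrite pnatr_eq0 -lt0n; case/andP: hk.
have m0 : ((n - k).+1%:R : R) != 0 by rewrite pnatr_eq0.
move: ((n - k).+1%:R : R) m0 => m m0.
(* With m = n - k + 1, the radicand is (n/k) m (n/m) k. *)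
rewrite (_ : _ * _ = n%:R ^+ 2) ?sqrtr_sqr ?ger0_norm //.
by field; rewrite k0 m0.
Qed.

(** The upper bound is sqrt(n) sqrt(n). For the lower one, the product formula at k = n is combined
    with the bound 1 on the distance from R_n to itself. *)
Lemma dcb_row_col (R : realType) (n : nat) : (0 < n)%N ->
  fine (dcb (Hspace R n n) (Hspace R n 1)) = n%:R.
Proof.
move=> n0; have hn : (0 < n <= n)%N by rewrite n0 leqnn.
have [rfin cfin] := dcb_Hnk_fin R hn.
have E := dcb_row_mul_col R hn.
apply/eqP; rewrite eq_le; apply/andP; split.
  have := dcb_Hnk_col R hn; rewrite -{1}(fineK cfin) lee_fin subnn divr1 => /le_trans; apply.
  by rewrite -sqrtrM // -expr2 sqrtr_sqr ger0_norm.
rewrite -E ler_piMl ?fine_ge0 ?dcb_ge0 //.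
have := dcb_Hnk_row R hn; rewrite -{1}(fineK rfin) lee_fin subnn sqrtr1 mulr1.
by rewrite divff ?sqrtr1 // pnatr_eq0 -lt0n.
Qed.

Theorem mainTheorem6 (R : realType) (n k : nat) (hk : (1 <= k)%N) (hkn : (k <= n)%N) :
  (dcb (Hspace R n k) (Hspace R n n) * dcb (Hspace R n k) (Hspace R n 1)
     = dcb (Hspace R n n) (Hspace R n 1))%E
  /\ [/\ osdim (Hspace R n k) = n, osdim (Hspace R n 1) = n
       & osdim (Hspace R n n) = n]
  /\ [/\ dcb (Hspace R n k) (Hspace R n n) \is a fin_num,
         dcb (Hspace R n k) (Hspace R n 1) \is a fin_num
       & dcb (Hspace R n n) (Hspace R n 1) \is a fin_num]
  /\ degenerate_triangle (@log_dcb R)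
       (Hspace R n k) (Hspace R n 1) (Hspace R n n).
Proof.
have hk1 : (0 < k <= n)%N by rewrite hk hkn.
have n0 : (0 < n)%N by exact: leq_trans hkn.
have hn : (0 < n <= n)%N by rewrite n0 leqnn.
have [rfin cfin] := dcb_Hnk_fin R hk1.
have [_ rcfin] := dcb_Hnk_fin R hn.
have E : fine (dcb (Hspace R n k) (Hspace R n n)) *
         fine (dcb (Hspace R n k) (Hspace R n 1)) =
         fine (dcb (Hspace R n n) (Hspace R n 1)).
  by rewrite dcb_row_mul_col // dcb_row_col.
split; first by rewrite -(fineK rfin) -(fineK cfin) -(fineK rcfin) -EFinM E.
split; first by split; exact: osdim_Hspace.
(* The equality is the one in which H_n^k lies between C_n and R_n. *)
split=> //; apply: Or33; rewrite /log_dcb (dcb_sym _ (Hspace R n n)) -E.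
rewrite (dcb_sym (Hspace R n 1)) mulrC lnM // posrE lt_def fine_ge0 ?dcb_ge0 // andbT.
  (* The logarithm of the product splits because neither factor is 0: their product is n > 0. *)
  by apply: contraTneq n0 => d0; rewrite -leqNgt -(ler_nat R) -(dcb_row_mul_col R hk1) d0 mulr0.
by apply: contraTneq n0 => d0; rewrite -leqNgt -(ler_nat R) -(dcb_row_mul_col R hk1) d0 mul0r.
Qed.
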